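(* Let $R$ be a commutative ring with nonzero identity, $I$ an ideal of $R$, $M$ a unitary $R$-module and $P$ a proper submodule of $M$. Then $P$ is an $I$-primary submodule of $M$ if and only if for any ideal $J$ of $R$ and any submodule $N$ of $M$ such that $JN\subseteq P$ and $JN\nsubseteq IP$, we have $J\subseteq\sqrt{(P:M)}$ or $N\subseteq P$.
   Context: For a submodule $P$ of $M$, $(P:M)=\{r\in R : rM\subseteq P\}$. For an ideal $A$ of $R$, $\sqrt{A}=\{a\in R : a^n\in A \text{ for some positive integer } n\}$. A proper submodule $P$ of $M$ is called an $I$-primary submodule of $M$ if for all $r\in R$ and $m\in M$, $rm\in P\setminus IP$ implies $m\in P$ or $r\in\sqrt{(P:M)}$. *)

(* Defs.v *)
From mathcomp Require Import all_boot all_order all_algebra.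
From mathcomp Require Import mathcomp_extra boolp classical_sets.

Set Implicit Arguments.
Unset Strict Implicit.
Unset Printing Implicit Defensive.

Import GRing.Theory.

Local Open Scope ring_scope.
Local Open Scope classical_set_scope.

(* Submodules are arbitrary (not necessarily decidable) subsets, on which
   [\in] is the classical membership of [classical_sets]. *)
Definition submodule (R : comNzRingType) (M : lmodType R) (P : set M) : Prop :=
  submod_closed (mem P).

(* Ideals are the submodules of the regular module [R^o]; unlike the
   [idealr_closed] of [ring_quotient], the unit ideal is allowed. *)
Definition ideal (R : comNzRingType) (A : set R) : Prop :=
  submodule (A : set R^o).

(* The product [A N] is the submodule generated by all [a *: m], i.e. the set
   of finite sums of such products, not just the set of products. *)
Definition smulset (R : comNzRingType) (M : lmodType R)
    (A : set R) (N : set M) : set M :=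
  smallest (@submodule R M) [set a *: m | a in A & m in N].

Definition colon (R : comNzRingType) (M : lmodType R) (P : set M) : set R :=
  [set r | forall m : M, P (r *: m)].

Definition radical (R : comNzRingType) (A : set R) : set R :=
  [set a | exists2 n : nat, (0 < n)%N & A (a ^+ n)].

Definition proper_submodule (R : comNzRingType) (M : lmodType R)
    (P : set M) : Prop :=
  submodule P /\ P <> setT.

Definition I_primary (R : comNzRingType) (M : lmodType R)
    (I : set R) (P : set M) : Prop :=
  proper_submodule P /\
  forall (r : R) (m : M),
    (P `\` smulset I P) (r *: m) -> P m \/ radical (colon P) r.

(* Main.v *)
Require Import Defs.
From mathcomp Require Import all_boot all_order all_algebra.
From mathcomp Require Import mathcomp_extra boolp classical_sets.

(** For the direct implication, a subgroup covered by two subgroups lies in one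
    of them. If [m] is in [N] but not in [P], then every [r] in [J] satisfies
    [r m \in IP] or [r \in sqrt (P : M)], so [J] not inside [sqrt (P : M)] forces
    [J m] into [IP]. Hence, for every [r] in [J], the group [N] is covered by [P]
    and [{m | r m \in IP}], and [N] not inside [P] forces [J N] into [IP]. For the
    converse, take [J = R r] and [N = R m]. *)

Set Implicit Arguments.
Unset Strict Implicit.
Unset Printing Implicit Defensive.

Import GRing.Theory.

Local Open Scope ring_scope.
Local Open Scope classical_set_scope.

(** Take [d] in [C] outside [B], hence in [A], and [c] in [C] lying in [B]. If [c + d] were in [B],
    so would be [d]; hence [c + d] is in [A], and subtracting [d] puts [c] in [A]. *)
Lemma subset_of_cover (V : zmodType) (A B C : set V) :
  (forall x y, A x -> A y -> A (x - y)) ->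
  (forall x y, B x -> B y -> B (x - y)) ->
  (forall x y, C x -> C y -> C (x + y)) ->
  C `<=` A `|` B -> ~ (C `<=` B) -> C `<=` A.
Proof.
move=> subA subB addC CAB /existsNP[d /not_implyP[Cd nBd]] c Cc.
have [//|Bc] := CAB _ Cc; have [Ad|//] := CAB _ Cd.
have [Acd|Bcd] := CAB _ (addC _ _ Cc Cd).
  by rewrite -(addrK d c); exact: subA.
by case: nBd; rewrite -(addKr c d) addrC; exact: subB.
Qed.

Lemma submoduleP (R : comNzRingType) (M : lmodType R) (P : set M) :
  submodule P <-> P 0 /\ forall a x y, P x -> P y -> P (a *: x + y).
Proof.
split=> -[P0 PL]; split.
- by move: P0; rewrite inE.
- by move=> a x y Px Py; have := PL a x y; rewrite !inE; apply.
- by rewrite inE.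
- by move=> a x y; rewrite !inE; exact: PL.
Qed.

Lemma submodule0 (R : comNzRingType) (M : lmodType R) (P : set M) :
  submodule P -> P 0.
Proof. by case/submoduleP. Qed.

Lemma submoduleD (R : comNzRingType) (M : lmodType R) (P : set M) :
  submodule P -> forall x y, P x -> P y -> P (x + y).
Proof.
by case/submoduleP=> _ PL x y Px Py; rewrite -[x]scale1r; exact: PL.
Qed.

Lemma submoduleZ (R : comNzRingType) (M : lmodType R) (P : set M) :
  submodule P -> forall a x, P x -> P (a *: x).
Proof.
by case/submoduleP=> P0 PL a x Px; rewrite -[_ *: _]addr0; exact: PL.
Qed.

Lemma submoduleB (R : comNzRingType) (M : lmodType R) (P : set M) :
  submodule P -> forall x y, P x -> P y -> P (x - y).
Proof.
move=> subP x y Px Py; apply: submoduleD => //.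
by rewrite -scaleN1r; exact: submoduleZ.
Qed.

(** Serves for [R m], and over the regular module [R^o] for the principal ideal [R r]. *)
Lemma submodule_cyclic (R : comNzRingType) (M : lmodType R) (m : M) :
  submodule (range (fun a : R => a *: m)).
Proof.
apply/submoduleP; split; first by exists 0; rewrite ?scale0r.
move=> a _ _ [b _ <-] [c _ <-].
by exists (a * b + c); rewrite // scalerDl scalerA.
Qed.

Lemma submodule_smulset (R : comNzRingType) (M : lmodType R)
    (A : set R) (N : set M) : submodule (smulset A N).
Proof.
apply/submoduleP; split=> [K [subK _]|a x y Ax Ay K KAN].
  exact: submodule0 subK.
have [subK _] := KAN.
by apply: submoduleD => //; [apply: submoduleZ => //; exact: Ax|exact: Ay].
Qed.

Lemma smulset_mem (R : comNzRingType) (M : lmodType R)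
    (A : set R) (N : set M) a m : A a -> N m -> smulset A N (a *: m).
Proof. by move=> Aa Nm K [_ ANK]; apply: ANK; exists a => //; exists m. Qed.

Lemma smulset_sub (R : comNzRingType) (M : lmodType R)
    (A : set R) (N K : set M) :
  submodule K -> (forall a m, A a -> N m -> K (a *: m)) ->
  smulset A N `<=` K.
Proof.
move=> subK ANK x; apply; split=> // _ [a Aa [m Nm <-]]; exact: ANK.
Qed.

Lemma ideal_colon (R : comNzRingType) (M : lmodType R) (P : set M) :
  submodule P -> ideal (colon P).
Proof.
move=> subP; apply/submoduleP; split=> [m|a r s Pr Ps m].
  by rewrite scale0r; exact: submodule0.
rewrite scalerDl -scalerA; apply: submoduleD => //; exact: submoduleZ.
Qed.

(** In the binomial expansion of [(x - y) ^+ (n + k)], every term contains [y ^+ k] or [x ^+ n]. *)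
Lemma radicalB (R : comNzRingType) (A : set R) : ideal A ->
  forall x y, radical A x -> radical A y -> radical A (x - y).
Proof.
move=> idA x y [n n_gt0 Axn] [k _ Ayk].
exists (n + k)%N; first by rewrite addn_gt0 n_gt0.
rewrite exprDn; apply: (big_ind A).
- exact: (submodule0 idA).
- exact: (submoduleD idA).
move=> i _; rewrite -mulr_natl; apply: (submoduleZ idA).
have [le_ki|lt_ik] := leqP k i.
  by rewrite exprNn -{3}(subnK le_ki) exprD !mulrA; exact: (submoduleZ idA _ Ayk).
(* Here [i < k], so the exponent [n + k - i] of [x] is [n + (k - i)] and [x ^+ n] splits off. *)
rewrite -addnBA 1?ltnW // exprD -mulrA mulrC.
exact: (submoduleZ idA _ Axn).
Qed.

Theorem theorem2p11 (R : comNzRingType) (I : set R) (M : lmodType R)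
    (P : set M) (idI : ideal I) (properP : proper_submodule P) :
  I_primary I P <->
  (forall (J : set R) (N : set M), ideal J -> submodule N ->
     smulset J N `<=` P -> ~ (smulset J N `<=` smulset I P) ->
     J `<=` radical (colon P) \/ N `<=` P).
Proof.
have [subP _] := properP; have subIP := submodule_smulset I P.
split=> [[_ primP] J N idJ subN JNP JN_IP|H].
- have [?|J_rad] := pselect (J `<=` radical (colon P)); first by left.
  have [?|N_P] := pselect (N `<=` P); first by right.
  (* It suffices to treat the generators of [J N]; the scalar [a] is fixed while the vector ranges
     over [N]. *)
  case: JN_IP; apply: smulset_sub => // a b Ja; move: b.
  apply: (@subset_of_cover _ [set m | smulset I P (a *: m)] P N) => //=.
  + by move=> x y IPx IPy; rewrite scalerBr; exact: (submoduleB subIP).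
  + exact: submoduleB.
  + exact: submoduleD.
  move=> m Nm; have [Pm|nPm] := pselect (P m); [by right|left => /=].
  (* The roles are exchanged: [m], outside [P], is now fixed and the scalar ranges over [J]. *)
  move: a Ja.
  apply: (@subset_of_cover _ [set r | smulset I P (r *: m)]
            (radical (colon P)) J) => //=.
  + by move=> x y IPx IPy; rewrite scalerBl; exact: (submoduleB subIP).
  + exact/radicalB/ideal_colon.
  + exact: (submoduleD idJ).
  move=> r Jr; have [IPrm|nIPrm] := pselect (smulset I P (r *: m)); [by left|].
  right; case: (primP r m) => //; split=> //.
  by apply: JNP; exact: smulset_mem.
- split=> // r m [Prm nIPrm].
  have Jr : range (fun a : R => a *: (r : R^o)) r by exists 1; rewrite ?scale1r.
  have Nm : range (fun a : R => a *: m) m by exists 1; rewrite ?scale1r.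
  have [||||JP|NP] := H (range (fun a : R => a *: (r : R^o)))
                        (range (fun a : R => a *: m)).
  + exact: submodule_cyclic.
  + exact: submodule_cyclic.
  (* [(a r)(b m) = (a b)(r m)] lies in [P] because [r m] does. *)
  + apply: smulset_sub => // _ _ [a _ <-] [b _ <-].
    rewrite -[a *: (r : R^o)]/(a * r) scalerA mulrAC -scalerA.
    exact: submoduleZ.
  + by move=> JN_IP; apply: nIPrm; exact: (JN_IP _ (smulset_mem Jr Nm)).
  + by right; exact: JP.
  + by left; exact: NP.
Qed.
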